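(* Let $G=(V,E,W)$ be a connected graph and $i,j\in V$ fixed distinct nodes. Then the map $\sigma\mapsto r^\sigma_{ij}$, defined on the set of $d$-dimensional signatures on $G$, is continuous.
   Context: $G$ finite connected weighted graph, $V=\{1,\dots,n\}$, $w_{xy}>0$ iff $\{x,y\}\in E$, $\deg(x)=\sum_yw_{xy}$. A $d$-dimensional signature is a map from oriented edges to $\mathsf{O}(d)$ with $\sigma_{yx}=\sigma_{xy}^{\mathrm T}$; the set of signatures is identified with $\mathsf{O}(d)^{E}$ (one matrix per edge with a fixed orientation) with the product topology. Connection Laplacian $\mathcal{L}^\sigma$: $nd\times nd$ block matrix with blocks $\deg(x)I_d$ on the diagonal, $-w_{xy}\sigma_{xy}$ for $x\sim y$, $0$ otherwise; $\dagger$ = Moore–Penrose pseudoinverse. $\Omega^0_{ij}=\mathbb{E}[\prod_{\ell=1}^{T^0_j}\sigma_{X_{\ell-1}X_\ell}\mid X_0=i]$ for the simple random walk with transition probabilities $w_{xy}/\deg(x)$ and $T^0_j=\inf\{t\ge0:X_t=j\}$. $N_{ij}$: $nd\times d$ block column with $I_d$ at node $i$, $-(\Omega^0_{ij})^{\mathrm T}$ at node $j$, $0$ elsewhere; $\mathcal{W}_{i\to j}=(\mathcal{L}^\sigma)^\dagger N_{ij}$. Connection effective resistance: $r^\sigma_{ij}=\frac{1}{2d}\operatorname{Tr}\big(\mathcal{W}_{i\to j}^{\mathrm T}\mathcal{L}^\sigma\mathcal{W}_{i\to j}+\mathcal{W}_{j\to i}^{\mathrm T}\mathcal{L}^\sigma\mathcal{W}_{j\to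 i}\big)$. *)

(* Defs.v *)
From HB Require Import structures.
From Stdlib Require Import ClassicalEpsilon.
From mathcomp Require Import all_boot all_order all_algebra.
From mathcomp Require Import all_classical all_reals all_analysis.
Set Implicit Arguments. Unset Strict Implicit. Unset Printing Implicit Defensive.
Import Order.TTheory GRing.Theory Num.Theory.
Import numFieldNormedType.Exports.
Local Open Scope ring_scope.

Section ConnectionResistance.
Variables (R : realType) (n d : nat) (w : 'I_n -> 'I_n -> R).

Definition deg (x : 'I_n) : R := \sum_(y < n) w x y.

Definition graph_rel : rel 'I_n := fun x y => 0 < w x y.
Definition connected_graph : Prop := forall x y : 'I_n, connect graph_rel x y.

Definition edge := {p : 'I_n * 'I_n | ((p.1 < p.2)%N && (0 < w p.1 p.2))}.

Definition orthogonal_mx : {pred 'M[R]_d} := fun A => A^T *m A == 1%:M.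

(* signature on oriented edges, given by one matrix per edge of fixed
   orientation, with sigma_yx = sigma_xy^T; 0 on non-edges (never used) *)
Definition sig_of (s : edge -> 'M[R]_d) (x y : 'I_n) : 'M[R]_d :=
  if @insub _ (fun p : 'I_n * 'I_n => (p.1 < p.2)%N && (0 < w p.1 p.2)) edge (x, y)
     is Some e then s e
  else if @insub _ (fun p : 'I_n * 'I_n => (p.1 < p.2)%N && (0 < w p.1 p.2)) edge (y, x)
     is Some e then (s e)^T
  else 0.

Definition trans (x y : 'I_n) : R := w x y / deg x.

Definition mxprod (l : seq 'M[R]_d) : 'M[R]_d := foldr mulmx 1%:M l.

(* contribution of the event {T^0_j = t} to E[ prod_{l=1}^{T^0_j} sigma | X_0 = i ]:
   sum over paths (x_0,...,x_t) with x_0 = i, x_t = j, x_k <> j for k < t *)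
Definition hit_term (s : edge -> 'M[R]_d) (i j : 'I_n) (t : nat) : 'M[R]_d :=
  \sum_(p : {ffun 'I_t.+1 -> 'I_n} |
         [&& p ord0 == i, p ord_max == j &
             [forall k : 'I_t.+1, (k < t)%N ==> (p k != j)]])
    ((\prod_(0 <= k < t) trans (p (inord k)) (p (inord k.+1)))
       *: mxprod [seq sig_of s (p (inord k)) (p (inord k.+1)) | k <- iota 0 t]).

(* Omega^0_{ij} = E[ prod_{l=1}^{T^0_j} sigma_{X_{l-1} X_l} | X_0 = i ] *)
Definition Omega0 (s : edge -> 'M[R]_d) (i j : 'I_n) : 'M[R]_d :=
  limn (fun N : nat => \sum_(t < N) hit_term s i j t).

Definition split_idx (p : 'I_(n * d)) : 'I_n * 'I_d :=
  enum_val (cast_ord (esym (mxvec_cast n d)) p).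

Definition conn_laplacian (s : edge -> 'M[R]_d) : 'M[R]_(n * d) :=
  \matrix_(p, q)
    let x := (split_idx p).1 in let a := (split_idx p).2 in
    let y := (split_idx q).1 in let b := (split_idx q).2 in
    if x == y then deg x * (a == b)%:R
    else if 0 < w x y then - (w x y * sig_of s x y a b) else 0.

(* Moore--Penrose pseudoinverse: the (unique) matrix satisfying the four
   Penrose equations *)
Definition penrose (m : nat) (A X : 'M[R]_m) : Prop :=
  [/\ A *m X *m A = A, X *m A *m X = X, (A *m X)^T = A *m X & (X *m A)^T = X *m A].
Definition pinv (m : nat) (A : 'M[R]_m) : 'M[R]_m :=
  epsilon (inhabits 0) (penrose A).

Definition Nmx (s : edge -> 'M[R]_d) (i j : 'I_n) : 'M[R]_(n * d, d) :=
  \matrix_(p, b)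
    let x := (split_idx p).1 in let a := (split_idx p).2 in
    if x == i then (a == b)%:R
    else if x == j then - ((Omega0 s i j)^T a b) else 0.

Definition Wmx (s : edge -> 'M[R]_d) (i j : 'I_n) : 'M[R]_(n * d, d) :=
  pinv (conn_laplacian s) *m Nmx s i j.

Definition conn_resistance (s : edge -> 'M[R]_d) (i j : 'I_n) : R :=
  (2 * d%:R)^-1 *
  \tr ((Wmx s i j)^T *m conn_laplacian s *m Wmx s i j
       + (Wmx s j i)^T *m conn_laplacian s *m Wmx s j i).

End ConnectionResistance.

(* Main.v *)
(* The rank of the connection Laplacian L may jump with the signature, so its
   pseudoinverse is not continuous.  However, grounding L at the node j (that is,
   replacing the rows of block j by those of the identity) always gives an
   invertible matrix: by the Dirichlet form a kernel element is a parallel section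
   vanishing at j, hence vanishes on the connected graph.  Let Z be the solution
   of the grounded system with source I_d at node i.  The map x |-> Omega0_xj is
   harmonic off j and equals I_d at j, so Green's identity gives
   (L Z)_j = -(Omega0_ij)^T, i.e. L Z = N_ij.  Therefore
   W^T L W = N^T Z = Z_i, a block of the inverse of an invertible matrix depending
   continuously on the signature. *)

Require Import Defs.
From Stdlib Require ClassicalEpsilon.
From HB Require Import structures.
From mathcomp Require Import all_boot all_order all_algebra.
From mathcomp Require Import ring.
From mathcomp Require Import all_classical all_reals all_analysis.
Set Implicit Arguments.
Unset Strict Implicit.
Unset Printing Implicit Defensive.
Import Order.TTheory GRing.Theory Num.Theory.
Import numFieldNormedType.Exports.
Local Open Scope ring_scope.
Local Open Scope classical_set_scope.

(** * Moore-Penrose inverses of real matrices *)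

Section PenroseInverse.
Context {R : realType}.

Lemma mxtrace_sqr_ge0 m k (A : 'M[R]_(m, k)) : 0 <= \tr (A^T *m A).
Proof.
apply: sumr_ge0 => x _; rewrite mxE; apply: sumr_ge0 => y _.
by rewrite mxE -expr2 sqr_ge0.
Qed.

Lemma mxtrace_sqr_eq0 m k (A : 'M[R]_(m, k)) : \tr (A^T *m A) = 0 -> A = 0.
Proof.
move=> /eqP; rewrite psumr_eq0; last first.
  by move=> x _; rewrite mxE; apply: sumr_ge0 => y _; rewrite mxE -expr2 sqr_ge0.
move=> /allP A0; apply/matrixP => x y; rewrite mxE; apply/eqP.
have := A0 y (mem_index_enum _); rewrite mxE psumr_eq0.
  by move=> /allP/(_ x (mem_index_enum _)); rewrite mxE mulf_eq0 orbb.
by move=> z _; rewrite mxE -expr2 sqr_ge0.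
Qed.

Lemma mulmx_tr_eq0 m n (A : 'M[R]_(m, n)) : A *m A^T = 0 -> A = 0.
Proof.
move=> A0; apply: trmx_inj; rewrite trmx0; apply: mxtrace_sqr_eq0.
by rewrite trmxK A0 mxtrace0.
Qed.

(** If [K] spans the left kernel of [A *m A^T], then [K *m A] times its transpose is 0, so
    [K *m A = 0]. *)
Lemma row_free_mul_tr m n (A : 'M[R]_(m, n)) :
  row_free A -> A *m A^T \in unitmx.
Proof.
move=> Afree; rewrite -row_free_unit -kermx_eq0; apply/eqP.
have KA : kermx (A *m A^T) *m A = 0.
  by apply: mulmx_tr_eq0; rewrite trmx_mul mulmxA -(mulmxA _ A) mulmx_ker mul0mx.
by apply: (row_free_inj Afree); rewrite KA mul0mx.
Qed.

(** With [P], [Q] the inverse Gram matrices, the two products collapse to the symmetric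
    [C *m Q *m C^T] and [B^T *m P *m B], whence all four equations. *)
Lemma penrose_full_rank m r (C : 'M[R]_(m, r)) (B : 'M[R]_(r, m)) :
    row_full C -> row_free B ->
  penrose (C *m B)
    (B^T *m invmx (B *m B^T) *m invmx (C^T *m C) *m C^T).
Proof.
move=> Cfull /row_free_mul_tr BU.
have CU : C^T *m C \in unitmx.
  by rewrite -{2}[C]trmxK; apply: row_free_mul_tr; rewrite /row_free mxrank_tr.
set P := invmx (B *m B^T); set Q := invmx (C^T *m C).
have Psym : P^T = P by rewrite trmx_inv trmx_mul trmxK.
have Qsym : Q^T = Q by rewrite trmx_inv trmx_mul trmxK.
set X := _ *m C^T.
have AX : C *m B *m X = C *m Q *m C^T.
  by rewrite /X !mulmxA -(mulmxA C B) -(mulmxA C _ P) mulmxV // mulmx1.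
have XA : X *m (C *m B) = B^T *m P *m B.
  by rewrite /X !mulmxA -(mulmxA _ _ C) -(mulmxA _ Q) mulVmx // mulmx1.
split.
- by rewrite AX !mulmxA -(mulmxA _ _ C) -(mulmxA _ Q) mulVmx // mulmx1.
- by rewrite XA /X !mulmxA -(mulmxA _ B) -(mulmxA _ (B *m _)) mulmxV // mulmx1.
- by rewrite AX !trmx_mul Qsym trmxK mulmxA.
- by rewrite XA !trmx_mul Psym trmxK mulmxA.
Qed.

(** A rank factorisation always exists; this witness makes the [epsilon] choice in [pinv]
    meaningful. *)
Lemma penrose_exists m (A : 'M[R]_m) : exists X, penrose A X.
Proof.
have := penrose_full_rank (col_base_full A) (row_base_free A).
by rewrite mulmx_base; eexists; eassumption.
Qed.

Lemma pinvP m (A : 'M[R]_m) : penrose A (Defs.pinv A).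
Proof. exact: (ClassicalEpsilon.epsilon_spec _ _ (penrose_exists A)). Qed.

(* For symmetric [A] and [N = A *m Z] in the range of [A], the energy does not
   see the choice of the preimage [Z]. *)
Lemma pinv_energy m k (A : 'M[R]_m) (N Z : 'M[R]_(m, k)) :
    A^T = A -> A *m Z = N ->
  (Defs.pinv A *m N)^T *m A *m (Defs.pinv A *m N) = N^T *m Z.
Proof.
move=> Asym AZ; have [AXA _ _ _] := pinvP A; set X := Defs.pinv A in AXA *.
have AXN : A *m (X *m N) = N by rewrite -AZ !mulmxA AXA.
rewrite -mulmxA AXN -{2}AZ mulmxA; congr (_ *m _).
by rewrite -{1}Asym -trmx_mul AXN.
Qed.

End PenroseInverse.

(** * Block columns indexed by vertices *)

Section Blocks.
Context {R : realType} {n d : nat}.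

Definition blk m (A : 'M[R]_(n * d, m)) (x : 'I_n) : 'M[R]_(d, m) :=
  \matrix_(a, b) A (mxvec_index x a) b.

Definition unblk m (f : 'I_n -> 'M[R]_(d, m)) : 'M[R]_(n * d, m) :=
  \matrix_(p, b) f (split_idx p).1 (split_idx p).2 b.

Lemma split_idxK (x : 'I_n) (a : 'I_d) : split_idx (mxvec_index x a) = (x, a).
Proof. by rewrite /split_idx /mxvec_index cast_ordK enum_rankK. Qed.

Lemma mxvec_index_split (p : 'I_(n * d)) :
  mxvec_index (split_idx p).1 (split_idx p).2 = p.
Proof.
by rewrite /split_idx /mxvec_index -surjective_pairing enum_valK cast_ordKV.
Qed.

Lemma sum_mxvec_index (V : nmodType) (F : 'I_(n * d) -> V) :
  \sum_p F p = \sum_x \sum_a F (mxvec_index x a).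
Proof.
rewrite pair_big (reindex (fun u => mxvec_index u.1 u.2)) //=.
exists (@split_idx n d) => [[x a]|p] _ /=; first exact: split_idxK.
exact: mxvec_index_split.
Qed.

Lemma blk_inj m (A B : 'M[R]_(n * d, m)) : blk A =1 blk B -> A = B.
Proof.
move=> AB; apply/matrixP => p b; rewrite -(mxvec_index_split p).
by have /matrixP/(_ (split_idx p).2 b) := AB (split_idx p).1; rewrite !mxE.
Qed.

Lemma unblkK m (f : 'I_n -> 'M[R]_(d, m)) x : blk (unblk f) x = f x.
Proof. by apply/matrixP => a b; rewrite !mxE split_idxK. Qed.

Lemma blk0 m x : blk (0 : 'M[R]_(n * d, m)) x = 0.
Proof. by apply/matrixP => a b; rewrite !mxE. Qed.

Lemma tr_mulmx_blk m k (A : 'M[R]_(n * d, m)) (B : 'M[R]_(n * d, k)) :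
  A^T *m B = \sum_x (blk A x)^T *m blk B x.
Proof.
apply/matrixP => a b; rewrite mxE summxE sum_mxvec_index.
by apply: eq_bigr => x _; rewrite mxE; apply: eq_bigr => c _; rewrite !mxE.
Qed.

End Blocks.

(** * The connection Laplacian and its grounding *)

Section Laplacian.
Context {R : realType} {n d : nat} {w : 'I_n -> 'I_n -> R}.
Hypotheses (wsym : forall x y, w x y = w y x) (wge0 : forall x y, 0 <= w x y)
  (wloop : forall x, w x x = 0).
Implicit Types (s : edge w -> 'M[R]_d) (x y j : 'I_n).

Lemma sig_of_tr s x y : sig_of s y x = (sig_of s x y)^T.
Proof.
rewrite /sig_of; case: insubP => [e|] /=.
  move=> /andP[yx _] ee; rewrite insubF /= ?trmxK //.
  by rewrite ltnNge (ltnW yx).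
move=> _; case: insubP => [e|] /= _; last by rewrite trmx0.
by [].
Qed.

Lemma conn_laplacian_tr s : (conn_laplacian s)^T = conn_laplacian s.
Proof.
apply/matrixP => p q; rewrite !mxE /= eq_sym; case: eqVneq => [->|pq].
  by rewrite eq_sym.
by rewrite wsym sig_of_tr mxE.
Qed.

Lemma blk_laplacian s m (A : 'M[R]_(n * d, m)) x :
  blk (conn_laplacian s *m A) x
  = deg w x *: blk A x - \sum_y w x y *: (sig_of s x y *m blk A y).
Proof.
apply/matrixP => a b; rewrite !mxE sum_mxvec_index (bigD1 x) //=.
congr (_ + _).
  rewrite (bigD1 a) //= !mxE !split_idxK /= !eqxx mulr1 big1 ?addr0 // => c ca.
  by rewrite !mxE !split_idxK /= eqxx eq_sym (negPf ca) mulr0 mul0r.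
(* The summand [y = x] on the right vanishes because there are no loops. *)
rewrite summxE [in RHS](bigD1 x) //= wloop scale0r mxE add0r -sumrN.
apply: eq_bigr => y yx; rewrite !mxE mulr_sumr -sumrN; apply: eq_bigr => c _.
rewrite !mxE !split_idxK /= eq_sym (negPf yx); case: ifPn => [_|].
  by rewrite mulNr mulrA.
rewrite -leNgt => w0; have -> : w x y = 0 by apply/eqP; rewrite eq_le w0 wge0.
by rewrite !mul0r oppr0.
Qed.

Definition grounded s j : 'M[R]_(n * d) := \matrix_(p, q)
  if (split_idx p).1 == j then (p == q)%:R else conn_laplacian s p q.

Lemma blk_grounded s j m (A : 'M[R]_(n * d, m)) x :
  blk (grounded s j *m A) x
  = if x == j then blk A j else blk (conn_laplacian s *m A) x.
Proof.
apply/matrixP => a b; case: eqVneq => [->|xj]; rewrite !mxE.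
  rewrite (bigD1 (mxvec_index j a)) //= mxE split_idxK /= !eqxx mul1r.
  rewrite big1 ?addr0 // => q qj.
  by rewrite mxE split_idxK /= eqxx eq_sym (negPf qj) mul0r.
by apply: eq_bigr => q _; congr (_ * _); rewrite !mxE split_idxK /= (negPf xj).
Qed.

Hypothesis hconn : connected_graph w.

Section Orthogonal.
Variable s : edge w -> 'M[R]_d.
Hypothesis sO : forall e, s e \in @orthogonal_mx R d.

Lemma sig_of_orthogonal x y : 0 < w x y ->
  (sig_of s x y)^T *m sig_of s x y = 1%:M.
Proof.
move=> wxy; rewrite /sig_of; case: insubP => [e _ _|]; first exact/eqP/sO.
rewrite wxy andbT -leqNgt => yx; case: insubP => [e _ _|].
  by rewrite trmxK; apply: mulmx1C; exact/eqP/sO.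
(* Neither orientation is stored, so [x = y], which the absence of loops excludes. *)
rewrite /= wsym wxy andbT -leqNgt => xy; move: wxy.
by rewrite (_ : x = y) ?wloop ?ltxx //; apply/val_inj/anti_leq/andP.
Qed.

(* Dirichlet form: the right-hand side vanishes only on parallel sections. *)
Lemma laplacian_energy m (A : 'M[R]_(n * d, m)) :
  2 * \tr (A^T *m (conn_laplacian s *m A)) =
  \sum_x \sum_y w x y * (let D := blk A x - sig_of s x y *m blk A y in
                         \tr (D^T *m D)).
Proof.
pose v := blk A; pose q x : R := \tr ((v x)^T *m v x).
pose c x y : R := \tr ((v x)^T *m (sig_of s x y *m v y)).
have csym x y : c y x = c x y.
  by rewrite /c -mxtrace_tr !trmx_mul trmxK sig_of_tr trmxK mulmxA.
have qE x y : w x y * (let D := v x - sig_of s x y *m v y in \tr (D^T *m D))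
    = w x y * q x + w x y * q y - 2 * (w x y * c x y).
  (* Orthogonality of [sig_of] is available only along edges, so zero weights are treated apart. *)
  have [w0|/eqP wn0] := eqVneq (w x y) 0; first by rewrite w0 !mul0r mulr0; ring.
  have wp : 0 < w x y by rewrite lt_neqAle wge0 andbT eq_sym; apply/eqP.
  rewrite /= mulmxBr (raddfB trmx) !mulmxBl !(raddfB mxtrace) /=.
  rewrite -/(q x) -/(c x y).
  rewrite trmx_mul -!mulmxA (mulmxA _^T _ (v y)) sig_of_orthogonal // mul1mx.
  by rewrite -sig_of_tr -/(c y x) -/(q y) csym; ring.
under [RHS]eq_bigr do under eq_bigr do rewrite qE.
rewrite tr_mulmx_blk raddf_sum /= mulr_sumr.
under [RHS]eq_bigr do rewrite sumrB big_split /=.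
(* Exchanging sums and the symmetry of [w] identify the two sums of squared norms. *)
rewrite sumrB big_split /= [X in _ + X - _]exchange_big /=.
rewrite [X in _ + X - _](eq_bigr (fun x => \sum_y w x y * q x)); last first.
  by move=> x _; apply: eq_bigr => y _; rewrite wsym.
have -> : \sum_x \sum_y 2 * (w x y * c x y) = 2 * \sum_x \sum_y w x y * c x y.
  by rewrite mulr_sumr; apply: eq_bigr => x _; rewrite mulr_sumr.
set P := \sum_x \sum_y w x y * q x; set C := \sum_x \sum_y w x y * c x y.
rewrite (_ : P + P - 2 * C = 2 * (P - C)); last by ring.
rewrite -mulr_sumr /P /C -sumrB; congr (_ * _).
apply: eq_bigr => x _; rewrite blk_laplacian mulmxBr raddfB /=.
rewrite -scalemxAr mxtraceZ -/(v x) -/(q x) /deg mulr_suml; congr (_ - _).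
rewrite mulmx_sumr raddf_sum /=; apply: eq_bigr => y _.
by rewrite -scalemxAr mxtraceZ.
Qed.

Lemma grounded_unit j : grounded s j \in unitmx.
Proof.
(* [kermx] is a left kernel; transposing turns it into columns [A] spanning the right kernel. *)
rewrite -unitmx_tr -row_free_unit -kermx_eq0; apply/eqP/trmx_inj.
set A := (kermx _)^T; rewrite trmx0.
have GA : grounded s j *m A = 0.
  by rewrite /A -[X in X *m _]trmxK -trmx_mul mulmx_ker trmx0.
have Aj : blk A j = 0.
  by have := blk_grounded s j A j; rewrite eqxx GA blk0.
have LA x : x != j -> blk (conn_laplacian s *m A) x = 0.
  by move=> xj; have := blk_grounded s j A x; rewrite (negPf xj) GA blk0.
(* The energy is zero: at [j] the block of [A] vanishes, elsewhere that of the Laplacian of [A]. *)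
have : 2 * \tr (A^T *m (conn_laplacian s *m A)) = 0.
  rewrite tr_mulmx_blk big1 ?linear0 ?mulr0 // => x _.
  by have [->|/LA ->] := eqVneq x j; rewrite ?mulmx0 // Aj trmx0 mul0mx.
have term_ge0 x y :
  0 <= w x y * (let D := blk A x - sig_of s x y *m blk A y in \tr (D^T *m D)).
  by rewrite mulr_ge0 // mxtrace_sqr_ge0.
rewrite laplacian_energy => /eqP; rewrite psumr_eq0; last first.
  by move=> x _; exact: sumr_ge0.
move=> /allP E0.
have par x y : graph_rel w x y -> blk A x = sig_of s x y *m blk A y.
  move=> wxy; have := E0 x (mem_index_enum _); rewrite psumr_eq0 //.
  move=> /allP/(_ y (mem_index_enum _)); rewrite mulf_eq0 gt_eqF //=.
  by move=> /eqP/mxtrace_sqr_eq0/eqP; rewrite subr_eq0 => /eqP.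
(* Parallel transport propagates vanishing along edges in both directions. *)
have cl : fingraph.closed (graph_rel w) [pred x | blk A x == 0].
  move=> x y xy; rewrite !inE.
  have yx : graph_rel w y x by rewrite /graph_rel wsym.
  apply/eqP/eqP => B0; first by rewrite (par _ _ yx) B0 mulmx0.
  by rewrite (par _ _ xy) B0 mulmx0.
apply: blk_inj => x; rewrite blk0; apply/eqP.
by have := closed_connect cl (hconn j x); rewrite !inE Aj eqxx => /esym.
Qed.

End Orthogonal.
End Laplacian.

(** * Limits of matrix-valued functions along a filter *)

Lemma cvg_mxP {R : realType} {m n : nat} {T : Type} {F : set_system T}
    {FF : Filter F} (f : T -> 'M[R]_(m, n)) (A : 'M[R]_(m, n)) :
  f x @[x --> F] --> A <-> forall i j, f x i j @[x --> F] --> A i j.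
Proof.
split=> [fA i j|fA].
  apply: (cvg_comp f (fun M : 'M[R]_(m, n) => M i j) fA).
  exact: coord_continuous.
(* A neighbourhood contains a box of entrywise neighbourhoods, and the filter can intersect finitely
   many of them. *)
move=> B [P AP PB]; apply: (@filterS _ F _ [set x | forall i j, P i j (f x i j)]).
  by move=> x Px; apply: PB.
have Pf i j : F [set x | P i j (f x i j)] := fA i j _ (AP i j).
have Pfi i : F [set x | forall j, P i j (f x i j)].
  exact: (@filter_forall T 'I_n (fun j => [set x | P i j (f x i j)]) F FF (Pf i)).
exact: (@filter_forall T 'I_m _ F FF Pfi).
Qed.

Lemma cvg_sumr {R : realType} {T : Type} {F : set_system T} {FF : Filter F}
    (I : Type) (r : seq I) (P : pred I) (f : I -> T -> R) (l : I -> R) :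
    (forall i, P i -> f i x @[x --> F] --> l i) ->
  \sum_(i <- r | P i) f i x @[x --> F] --> \sum_(i <- r | P i) l i.
Proof. by move=> fl; apply: cvg_big => //; exact: add_continuous. Qed.

Lemma cvg_prodr {R : realType} {T : Type} {F : set_system T} {FF : Filter F}
    (I : Type) (r : seq I) (P : pred I) (f : I -> T -> R) (l : I -> R) :
    (forall i, P i -> f i x @[x --> F] --> l i) ->
  \prod_(i <- r | P i) f i x @[x --> F] --> \prod_(i <- r | P i) l i.
Proof. by move=> fl; apply: cvg_big => //; exact: mul_continuous. Qed.

Lemma cvg_mulmx {R : realType} {T : Type} {F : set_system T} {FF : Filter F}
    m n p (f : T -> 'M[R]_(m, n)) (g : T -> 'M[R]_(n, p))
    (A : 'M[R]_(m, n)) (B : 'M[R]_(n, p)) :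
    f x @[x --> F] --> A -> g x @[x --> F] --> B ->
  f x *m g x @[x --> F] --> A *m B.
Proof.
move=> /cvg_mxP fA /cvg_mxP gB; apply/cvg_mxP => i j; rewrite mxE.
under eq_fun do rewrite mxE.
by apply: cvg_sumr => k _; apply: cvgM.
Qed.

Lemma cvg_det {R : realType} {T : Type} {F : set_system T} {FF : Filter F}
    m (f : T -> 'M[R]_m) (A : 'M[R]_m) :
  f x @[x --> F] --> A -> \det (f x) @[x --> F] --> \det A.
Proof.
move=> /cvg_mxP fA; rewrite /determinant; apply: cvg_sumr => s _.
by apply: cvgMl_tmp; apply: cvg_prodr => i _; exact: fA.
Qed.

(** The adjugate formula is continuous but equals [invmx] only on invertible matrices; near the
    limit the determinant stays nonzero. *)
Lemma cvg_invmx {R : realType} {T : Type} {F : set_system T} {FF : Filter F}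
    m (f : T -> 'M[R]_m) (A : 'M[R]_m) :
  A \in unitmx -> f x @[x --> F] --> A -> invmx (f x) @[x --> F] --> invmx A.
Proof.
move=> AU fA; have A0 : \det A != 0 by move: AU; rewrite unitmxE unitfE.
have fU : \forall x \near F, f x \in unitmx.
  apply: filterS (cvgr_neq0 _ (cvg_det fA) A0) => x.
  by rewrite unitmxE unitfE.
apply: (@cvg_trans _ ((\det (f x))^-1 *: \adj (f x) @[x --> F])).
  by apply: near_eq_cvg; apply: filterS fU => x xU; rewrite /invmx xU.
rewrite /invmx AU; apply/cvg_mxP => i j; rewrite !mxE.
under eq_fun do rewrite !mxE.
apply: cvgM; first by apply: cvgV => //; exact: cvg_det.
apply: cvgMl_tmp; apply: cvg_det; apply/cvg_mxP => k l.
by rewrite !mxE; under eq_fun do rewrite !mxE; move/cvg_mxP : fA; exact.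
Qed.

(** * Splitting off the first step of a path *)

Section Paths.
Context {T : eqType} {t : nat}.

Definition path_cons (x : T) (q : {ffun 'I_t.+1 -> T}) : {ffun 'I_t.+2 -> T} :=
  [ffun k => if unlift ord0 k is Some k' then q k' else x].

Definition path_tail (p : {ffun 'I_t.+2 -> T}) : {ffun 'I_t.+1 -> T} :=
  [ffun k => p (lift ord0 k)].

Lemma path_cons0 x q : path_cons x q ord0 = x.
Proof. by rewrite ffunE unlift_none. Qed.

Lemma path_consS x q k : path_cons x q (lift ord0 k) = q k.
Proof. by rewrite ffunE liftK. Qed.

Lemma path_consK x : cancel (path_cons x) path_tail.
Proof. by move=> q; apply/ffunP => k; rewrite ffunE path_consS. Qed.

Lemma path_tailK (p : {ffun 'I_t.+2 -> T}) : path_cons (p ord0) (path_tail p) = p.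
Proof.
by apply/ffunP => k; rewrite !ffunE; case: unliftP => [k'|] ->; rewrite ?ffunE.
Qed.

Lemma path_cons_inord x q k : (k <= t)%N ->
  path_cons x q (inord k.+1) = q (inord k).
Proof.
move=> kt; rewrite -(path_consS x); congr (path_cons x q _); apply: val_inj.
by rewrite /= inordK // /bump inordK.
Qed.

Lemma path_cons_avoid x q (j : T) :
  [forall k : 'I_t.+2, (k < t.+1)%N ==> (path_cons x q k != j)] =
  (x != j) && [forall k : 'I_t.+1, (k < t)%N ==> (q k != j)].
Proof.
apply/forallP/andP => [avoid|[xj /forallP avoid] k].
  split; first by have := avoid ord0; rewrite path_cons0.
  apply/forallP => k; have := avoid (lift ord0 k).
  by rewrite path_consS lift0 ltnS.
case: (unliftP ord0 k) => [k' ->|->]; last by rewrite path_cons0.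
by rewrite path_consS lift0 ltnS.
Qed.

End Paths.

(** * First hitting times and the expected transport [Omega0] *)

Section Hitting.
Context {R : realType} {n d : nat} {w : 'I_n -> 'I_n -> R}.
Hypotheses (wsym : forall x y, w x y = w y x) (wge0 : forall x y, 0 <= w x y)
  (wloop : forall x, w x x = 0).
Implicit Types (x y j : 'I_n).

Section Recurrence.
Variable s : edge w -> 'M[R]_d.

Lemma hit_term0 x j : hit_term s x j 0 = if x == j then 1%:M else 0.
Proof.
rewrite /hit_term (_ : ord_max = ord0 :> 'I_1); last exact: val_inj.
case: eqVneq => [<-|xj].
  rewrite (big_pred1 [ffun=> x]) /= ?big_nil ?scale1r // => p.
  rewrite andbA andbb; apply/andP/eqP => [[/eqP p0 _]|->].
    by apply/ffunP => k; rewrite ffunE ord1.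
  by rewrite ffunE; split => //; apply/forallP.
by rewrite big_pred0 // => p; apply/and3P => -[/eqP->]; rewrite (negPf xj).
Qed.

Lemma hit_termSj j t : hit_term s j j t.+1 = 0.
Proof.
rewrite /hit_term big_pred0 // => p; apply/and3P => -[/eqP p0 _].
by move=> /forallP/(_ ord0); rewrite p0 eqxx.
Qed.

(** First-step analysis: paths are grouped by their vertex at time 1, then their start is removed
    with [path_tail]. *)
Lemma hit_termS x j t : x != j -> hit_term s x j t.+1 =
  \sum_y trans w x y *: (sig_of s x y *m hit_term s y j t).
Proof.
move=> xj; rewrite /hit_term.
rewrite (partition_big
  (fun p : {ffun 'I_t.+2 -> 'I_n} => p (inord 1)) xpredT) //=.
apply: eq_bigr => y _; rewrite mulmx_sumr scaler_sumr.
rewrite (reindex_onto (path_cons x) path_tail); last first.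
  by move=> p /andP[/and3P[/eqP<- _ _] _]; exact: path_tailK.
have max : ord_max = lift ord0 ord_max :> 'I_t.+2.
  by apply: val_inj; rewrite /= /bump.
apply: eq_big => q.
  rewrite path_consK eqxx andbT path_cons0 eqxx max path_consS path_cons_avoid xj.
  rewrite path_cons_inord // (_ : inord 0 = ord0) 1?andbC //.
  by apply: val_inj; rewrite /= inordK.
rewrite path_consK eqxx andbT => /andP[_ /eqP q1].
rewrite big_nat_recl //= (_ : inord 0 = ord0); last first.
  by apply: val_inj; rewrite /= inordK.
rewrite path_cons0 q1 -scalemxAr scalerA.
congr (_ *: _).
  congr (_ * _); apply: eq_big_nat => k /andP[_ kt].
  by rewrite !path_cons_inord // ltnW.
(* Shifting the time list by one aligns the signature products along [path_cons x q] and [q]. *)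
congr mulmx; rewrite (iotaDl 1 0) -map_comp; congr mxprod.
apply/eq_in_map => k; rewrite mem_iota /= => kt.
by rewrite !path_cons_inord // ltnW.
Qed.

End Recurrence.

(** Law of the first hitting time of [j] from [x]; it serves as scalar majorant of [hit_term]. *)
Fixpoint hit_prob j t x : R :=
  if t is t'.+1 then
    if x == j then 0 else \sum_y trans w x y * hit_prob j t' y
  else (x == j)%:R.

Lemma deg_ge0 x : 0 <= deg w x.
Proof. exact: sumr_ge0. Qed.

Lemma trans_ge0 x y : 0 <= trans w x y.
Proof. by rewrite divr_ge0 // deg_ge0. Qed.

(** Equality fails only at an isolated vertex, where division by zero yields 0. *)
Lemma sum_trans_le1 x : \sum_y trans w x y <= 1.
Proof.
rewrite -mulr_suml -/(deg w x); have [->|d0] := eqVneq (deg w x) 0.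
  by rewrite mul0r.
by rewrite divff.
Qed.

(* Also correct at an isolated vertex, where [trans] is a division by 0. *)
Lemma deg_trans x y : deg w x * trans w x y = w x y.
Proof.
have [d0|d0] := eqVneq (deg w x) 0; last by rewrite mulrC divfK.
rewrite d0 mul0r; have /eqP := d0; rewrite psumr_eq0 // => /allP/(_ y).
by rewrite mem_index_enum => /(_ isT)/eqP.
Qed.

Lemma hit_prob_ge0 j t x : 0 <= hit_prob j t x.
Proof.
elim: t x => [|t IH] x /=; first exact: ler0n.
by case: ifP => // _; apply: sumr_ge0 => y _; rewrite mulr_ge0 // trans_ge0.
Qed.

(** Hitting at different times gives disjoint events; the induction conditions on the first step. *)
Lemma sum_hit_prob_le1 j N x : \sum_(t < N) hit_prob j t x <= 1.
Proof.
elim: N x => [|N IH] x; first by rewrite big_ord0.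
rewrite big_ord_recl /=; have [_|xj] := eqVneq x j.
  by rewrite big1 ?addr0.
rewrite add0r exchange_big /= (le_trans _ (sum_trans_le1 x)) //.
apply: ler_sum => y _; rewrite -mulr_sumr ler_piMr ?trans_ge0 //.
Qed.

(** The diagonal entry [b] of [U^T *m U] is the squared norm of column [b]. *)
Lemma orthogonal_entry_le1 (U : 'M[R]_d) a b : U^T *m U = 1%:M -> `|U a b| <= 1.
Proof.
move=> /matrixP/(_ b b); rewrite !mxE eqxx mulr1n (bigD1 a) //= mxE => U1.
rewrite -(ler_pXn2r (n:=2)) ?nnegrE // expr1n real_normK ?num_real // -U1 expr2.
by rewrite lerDl; apply: sumr_ge0 => c _; rewrite mxE -expr2 sqr_ge0.
Qed.

Section Convergence.
Variable s : edge w -> 'M[R]_d.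
Hypothesis sO : forall e, s e \in @orthogonal_mx R d.

(* The orthogonal factor [U] makes the induction on [t] go through. *)
Lemma hit_term_le (U : 'M[R]_d) x j t a b : U^T *m U = 1%:M ->
  `|(U *m hit_term s x j t) a b| <= hit_prob j t x.
Proof.
elim: t x U => [|t IH] x U UO.
  rewrite hit_term0 /=; case: eqP => _; last by rewrite mulmx0 mxE normr0.
  by rewrite mulmx1 orthogonal_entry_le1.
have [->|xj] := eqVneq x j.
  by rewrite hit_termSj mulmx0 mxE normr0 hit_prob_ge0.
rewrite hit_termS //= (negPf xj) mulmx_sumr summxE.
rewrite (le_trans (ler_norm_sum _ _ _)) //.
apply: ler_sum => y _; rewrite -scalemxAr mxE normrM ger0_norm ?trans_ge0 //.
have [w0|/eqP wn0] := eqVneq (w x y) 0; first by rewrite /trans w0 !mul0r.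
(* Along an edge [U *m sig_of s x y] is again orthogonal and can play the role of [U]. *)
rewrite ler_wpM2l ?trans_ge0 // mulmxA IH // trmx_mul -mulmxA (mulmxA U^T) UO.
rewrite mul1mx; apply: (sig_of_orthogonal wsym wloop) => //.
by rewrite lt_neqAle wge0 andbT eq_sym; apply/eqP.
Qed.

(** Domination by [hit_prob], whose partial sums increase and stay below 1. *)
Lemma is_cvg_Omega0 x j a b :
  cvgn (fun N => (\sum_(t < N) hit_term s x j t) a b).
Proof.
have -> : (fun N => (\sum_(t < N) hit_term s x j t) a b) =
          series (fun t => hit_term s x j t a b).
  by apply/funext => N; rewrite summxE /series /= big_mkord.
apply: (@normed_cvg R R^o).
apply: (series_le_cvg (v_ := fun t => hit_prob j t x)).
- by move=> t /=.
- by move=> t; exact: hit_prob_ge0.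
- move=> t /=; rewrite -{1}[hit_term _ _ _ _]mul1mx hit_term_le //.
  by rewrite trmx1 mulmx1.
apply: nondecreasing_is_cvgn.
  by apply/nondecreasing_seqP => N; rewrite seriesSr lerDl hit_prob_ge0.
exists 1 => _ [N _ <-]; rewrite /series /= big_mkord.
exact: sum_hit_prob_le1.
Qed.

(** The entrywise limits form a matrix limit, which uniqueness identifies with the [limn] in
    [Omega0]. *)
Lemma Omega0_cvg x j :
  \sum_(t < N) hit_term s x j t @[N --> \oo] --> Omega0 s x j.
Proof.
pose l : 'M[R]_d := \matrix_(a, b)
  limn (fun N => (\sum_(t < N) hit_term s x j t) a b).
have Sl : \sum_(t < N) hit_term s x j t @[N --> \oo] --> l.
  by apply/cvg_mxP => a b; rewrite mxE; exact: is_cvg_Omega0.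
by rewrite /Omega0 (cvg_lim (@norm_hausdorff _ _) Sl).
Qed.

Lemma Omega0_id j : Omega0 s j j = 1%:M.
Proof.
(* The shift discards the empty partial sum; all later ones equal the identity. *)
apply: (cvg_lim (@norm_hausdorff _ _)); rewrite -cvg_shiftS.
apply: cvg_near_cst; apply: nearW => N /=; rewrite big_ord_recl hit_term0 eqxx.
by rewrite big1 ?addr0 // => t _; exact: hit_termSj.
Qed.

(** The first-step recurrence passes to the limit; multiplying by the degree clears the division in
    [trans]. *)
Lemma Omega0_harmonic x j : x != j ->
  deg w x *: Omega0 s x j = \sum_y w x y *: (sig_of s x y *m Omega0 s y j).
Proof.
move=> xj; have -> : Omega0 s x j =
    \sum_y trans w x y *: (sig_of s x y *m Omega0 s y j).
  (* After the shift the length-zero term is 0 since [x != j], and the other [N] terms reduce to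
     partial sums of [N] terms. *)
  apply: (cvg_lim (@norm_hausdorff _ _)); rewrite -cvg_shiftS.
  apply: (@cvg_trans _ ((\sum_y trans w x y *: (sig_of s x y *m
     \sum_(t < N) hit_term s y j t)) @[N --> \oo])).
    apply: near_eq_cvg; apply: nearW => N /=.
    rewrite big_ord_recl hit_term0 (negPf xj) add0r.
    under [in RHS]eq_bigr do rewrite hit_termS //.
    rewrite exchange_big /=; apply: eq_bigr => y _.
    by rewrite mulmx_sumr scaler_sumr.
  apply: cvg_big; first exact: add_continuous.
  move=> y _; apply: cvgZl_tmp; apply: cvg_mulmx; first exact: cvg_cst.
  exact: Omega0_cvg.
rewrite scaler_sumr; apply: eq_bigr => y _.
by rewrite scalerA deg_trans.
Qed.

End Convergence.
End Hitting.

(** * The energy as a block of the grounded inverse, and its continuity *)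

Section Resistance.
Context {R : realType} {n d : nat} {w : 'I_n -> 'I_n -> R}.
Hypotheses (wsym : forall x y, w x y = w y x) (wge0 : forall x y, 0 <= w x y)
  (wloop : forall x, w x x = 0) (hconn : connected_graph w).
Implicit Types (x y i j : 'I_n).

Definition pole i : 'M[R]_(n * d, d) :=
  unblk (fun x => if x == i then 1%:M else 0).

(** Potential of a unit source at [i] with [j] grounded. *)
Definition grounded_potential (s : edge w -> 'M[R]_d) i j : 'M[R]_(n * d, d) :=
  invmx (grounded s j) *m pole i.

Section Orthogonal.
Variable s : edge w -> 'M[R]_d.
Hypothesis sO : forall e, s e \in @orthogonal_mx R d.

Lemma grounded_mul_potential i j :
  grounded s j *m grounded_potential s i j = pole i.
Proof. by rewrite /grounded_potential mulKVmx // grounded_unit. Qed.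

Lemma grounded_potential_ground i j : i != j ->
  blk (grounded_potential s i j) j = 0.
Proof.
move=> ij; have := blk_grounded s j (grounded_potential s i j) j.
by rewrite eqxx grounded_mul_potential unblkK eq_sym (negPf ij).
Qed.

Lemma laplacian_grounded_potential i j x : x != j ->
  blk (conn_laplacian s *m grounded_potential s i j) x =
  if x == i then 1%:M else 0.
Proof.
move=> xj; have := blk_grounded s j (grounded_potential s i j) x.
by rewrite (negPf xj) grounded_mul_potential unblkK.
Qed.

Lemma laplacian_Omega0 x j : x != j ->
  blk (conn_laplacian s *m unblk (fun y => Omega0 s y j)) x = 0.
Proof.
move=> xj; rewrite blk_laplacian // unblkK Omega0_harmonic //.
by under [X in _ - X]eq_bigr do rewrite unblkK; rewrite subrr.
Qed.

(* Green's identity against the harmonic section [x |-> Omega0 s x j]. *)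
Lemma laplacian_grounded_potential_ground i j : i != j ->
  blk (conn_laplacian s *m grounded_potential s i j) j = - (Omega0 s i j)^T.
Proof.
move=> ij; set Z := grounded_potential s i j.
pose W := unblk (fun y => Omega0 s y j).
have : W^T *m (conn_laplacian s *m Z) = (conn_laplacian s *m W)^T *m Z.
  by rewrite trmx_mul conn_laplacian_tr // mulmxA.
(* Every block product on the right vanishes: [Z] is 0 at [j], the Laplacian of [W] is 0
   elsewhere. *)
rewrite !tr_mulmx_blk [RHS]big1; last first.
  move=> x _; have [->|xj] := eqVneq x j.
    by rewrite grounded_potential_ground // mulmx0.
  by rewrite laplacian_Omega0 // trmx0 mul0mx.
(* On the left only [j], with weight [Omega0 s j j = 1%:M], and the source [i] contribute. *)
rewrite (bigD1 j) //= (bigD1 i) //= big1; last first.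
  move=> x /andP[xj xi]; rewrite laplacian_grounded_potential // (negPf xi).
  by rewrite mulmx0.
rewrite (laplacian_grounded_potential i ij) eqxx !unblkK Omega0_id //.
by rewrite trmx1 mul1mx mulmx1 addr0 => /eqP; rewrite addr_eq0 => /eqP.
Qed.

Lemma blk_Nmx i j x : blk (Nmx s i j) x =
  if x == i then 1%:M else if x == j then - (Omega0 s i j)^T else 0.
Proof.
apply/matrixP => a b; rewrite !mxE split_idxK /=.
by case: eqP => _; [rewrite !mxE|case: eqP => _; rewrite !mxE].
Qed.

(** This puts [Nmx] in the range of the Laplacian, so [pinv_energy] can eliminate the
    pseudoinverse. *)
Lemma laplacian_potential_Nmx i j : i != j ->
  conn_laplacian s *m grounded_potential s i j = Nmx s i j.
Proof.
move=> ij; apply: blk_inj => x; rewrite blk_Nmx.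
have [->|xj] := eqVneq x j; last by rewrite laplacian_grounded_potential.
by rewrite eq_sym (negPf ij) laplacian_grounded_potential_ground.
Qed.

(** Only block [i] survives in the pairing of [Nmx] with the potential, which vanishes at [j]. *)
Lemma Wmx_energy i j : i != j ->
  (Wmx s i j)^T *m conn_laplacian s *m Wmx s i j =
  blk (grounded_potential s i j) i.
Proof.
move=> ij; rewrite (pinv_energy _ (laplacian_potential_Nmx ij)); last first.
  exact: conn_laplacian_tr.
rewrite tr_mulmx_blk (bigD1 i) //= blk_Nmx eqxx trmx1 mul1mx big1 ?addr0 //.
move=> x xi; have [->|xj] := eqVneq x j.
  by rewrite grounded_potential_ground // mulmx0.
by rewrite blk_Nmx (negPf xi) (negPf xj) trmx0 mul0mx.
Qed.

Lemma conn_resistanceE i j : i != j -> conn_resistance s i j =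
  (2 * d%:R)^-1 * (\tr (blk (grounded_potential s i j) i)
                   + \tr (blk (grounded_potential s j i) j)).
Proof.
move=> ij; have ji : j != i by rewrite eq_sym.
by rewrite /conn_resistance !Wmx_energy // mxtraceD.
Qed.

End Orthogonal.

Section Convergence.
Context {T : Type} {F : set_system T} {FF : Filter F}.
Variables (f : T -> edge w -> 'M[R]_d) (s : edge w -> 'M[R]_d).
Hypothesis fs : forall e, f t e @[t --> F] --> s e.

(** The branch taken in [sig_of] is decided by the weights and the vertices alone. *)
Lemma cvg_sig_of x y : sig_of (f t) x y @[t --> F] --> sig_of s x y.
Proof.
rewrite /sig_of; case: insub => [e|]; first exact: fs.
case: insub => [e|]; last exact: cvg_cst.
apply/cvg_mxP => a b; rewrite mxE; under eq_fun do rewrite mxE.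
by have /cvg_mxP := @fs e; exact.
Qed.

Lemma cvg_grounded j : grounded (f t) j @[t --> F] --> grounded s j.
Proof.
apply/cvg_mxP => p q; rewrite mxE; under eq_fun do rewrite mxE.
case: ifP => _; first exact: cvg_cst.
rewrite mxE /=; under eq_fun do rewrite mxE /=.
case: ifP => _; first exact: cvg_cst.
case: ifP => _; last exact: cvg_cst.
apply: cvgN; apply: cvgMl_tmp.
by have /cvg_mxP := @cvg_sig_of (split_idx p).1 (split_idx q).1; exact.
Qed.

(** Orthogonality at the limit makes the grounded matrix invertible there, which is what [cvg_invmx]
    requires. *)
Lemma cvg_grounded_potential i j :
    (forall e, s e \in @orthogonal_mx R d) ->
  \tr (blk (grounded_potential (f t) i j) i) @[t --> F] -->
  \tr (blk (grounded_potential s i j) i).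
Proof.
move=> sO; apply: cvg_sumr => a _; rewrite mxE; under eq_fun do rewrite mxE.
have /cvg_mxP :
    grounded_potential (f t) i j @[t --> F] --> grounded_potential s i j.
  apply: cvg_mulmx; last exact: cvg_cst.
  by apply: cvg_invmx; [exact: grounded_unit|exact: cvg_grounded].
exact.
Qed.

End Convergence.
End Resistance.

(** * Continuity on the set of signatures *)

Theorem theorem6p11 (R : realType) (n d : nat) (w : 'I_n -> 'I_n -> R)
  (hd : (0 < d)%N)
  (wsym : forall x y, w x y = w y x)
  (wge0 : forall x y, 0 <= w x y)
  (wloop : forall x, w x x = 0)
  (hconn : connected_graph w)
  (i j : 'I_n) (hij : i != j) :
  {within [set s : {ptws edge w -> 'M[R]_d} | forall e, s e \in @orthogonal_mx R d],
    continuous (fun s : {ptws edge w -> 'M[R]_d} => conn_resistance s i j)}.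
Proof.
(* [g] agrees with the resistance on signatures but makes sense for all edge maps, so its continuity
   can be checked in the ambient space. *)
pose g (s : {ptws edge w -> 'M[R]_d}) := (2 * d%:R)^-1 *
  (\tr (blk (grounded_potential s i j) i)
   + \tr (blk (grounded_potential s j i) j)).
apply: (@subspace_eq_continuous _ _ _ g).
  by move=> s /set_mem sO; rewrite /g /from_subspace conn_resistanceE.
apply: continuous_in_subspaceT => s /set_mem sO.
have FF : Filter (nbhs s) := nbhs_filter s.
(* In the product topology evaluation at an edge is continuous. *)
have ev e : t e @[t --> s] --> s e.
  exact: (@proj_continuous (edge w) (fun=> 'M[R]_d) e).
apply: (@cvgMl_tmp _ _ _ FF); apply: (@cvgD _ _ _ _ FF).
  exact: (@cvg_grounded_potential _ _ _ _ wsym wge0 wloop hconn _ _ FF id s ev).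
exact: (@cvg_grounded_potential _ _ _ _ wsym wge0 wloop hconn _ _ FF id s ev).
Qed.
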